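(* There is an absolute constant $c>0$ such that for all integers $k\ge 1$, all integers $n\ge 3k$ and all integers $\ell\ge 4$, $$r_k(n;\ell)>t_k(cn).$$ In particular, the four-color Ramsey number satisfies $r_k(n;4)>t_k(cn)$ for all $k$ and all $n\ge 3k$.
   Context: $r_k(n;\ell)$ denotes the minimum $N$ such that every coloring of the $k$-element subsets of an $N$-element set with $\ell$ colors contains a monochromatic subset of size $n$, i.e. a subset of size $n$ all of whose $k$-element subsets have the same color. The tower function $t_k(x)$ is defined by $t_1(x)=x$ and $t_{i+1}(x)=2^{t_i(x)}$. The constant $c$ does not depend on $k$, $n$ or $\ell$. *)

(* Defs.v *)
From HB Require Import structures.
From mathcomp Require Import all_boot all_order all_algebra.
From mathcomp Require Import reals exp.

Set Implicit Arguments.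
Unset Strict Implicit.
Unset Printing Implicit Defensive.

Import Order.TTheory GRing.Theory Num.Theory.

Definition ksubset (N k : nat) := {A : {set 'I_N} | #|A| == k}.

Definition coloring (N k l : nat) := {ffun ksubset N k -> 'I_l}.

Definition monochromatic (N k l : nat) (chi : coloring N k l)
    (S : {set 'I_N}) : bool :=
  [forall A : ksubset N k, [forall B : ksubset N k,
    (val A \subset S) && (val B \subset S) ==> (chi A == chi B)]].

Definition ramsey_prop (k n l N : nat) : bool :=
  [forall chi : coloring N k l,
    [exists S : {set 'I_N}, (#|S| == n) && monochromatic chi S]].

(* Ramsey's theorem, with the size of the ambient set left open: needed to know
   that the minimum defining the Ramsey number exists. *)
Lemma ramsey_sets (l k n : nat) : exists N : nat,
  forall (T : finType) (V : {set T}) (f : {set T} -> 'I_l), N <= #|V| ->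
  exists (i : 'I_l) (S : {set T}), [/\ S \subset V, #|S| = n &
    forall A : {set T}, A \subset S -> #|A| = k -> f A = i].
Proof.
elim: k n => [|k IHk] n.
  exists n => T V f leV.
  have [S SV cS] : exists2 S : {set T}, S \subset V & #|S| = n.
    have /set0Pn[S] : [set B : {set T} | B \subset V & #|B| == n] != set0.
      by rewrite -card_gt0 cards_draws bin_gt0.
    by rewrite inE => /andP[SV /eqP cS]; exists S.
  by exists (f set0), S; split => // A _ /eqP; rewrite cards_eq0 => /eqP ->.
suff asym s : exists N, forall (a : 'I_l -> nat), \sum_(i < l) a i <= s ->
  forall (T : finType) (V : {set T}) (f : {set T} -> 'I_l), N <= #|V| ->
  exists (i : 'I_l) (S : {set T}), [/\ S \subset V, #|S| = a i &
    forall A : {set T}, A \subset S -> #|A| = k.+1 -> f A = i].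
  have [N HN] := asym (\sum_(i < l) n); exists N => T V f leV.
  exact: (HN (fun=> n) (leqnn _) T V f leV).
elim: s => [|s [N' IHs]].
  exists 0 => a; rewrite leqn0 sum_nat_eq0 => /forallP a0 T V f _.
  exists (f set0), set0; rewrite sub0set cards0; split => //.
    by have /eqP -> := a0 (f set0).
  by move=> A; rewrite subset0 => /eqP ->; rewrite cards0.
have [M HM] := IHk N'; exists M.+1 => a sa T V f leV.
have /card_gt0P[x xV] : 0 < #|V| by exact: leq_trans leV.
have leM : M <= #|V :\ x| by rewrite (cardsD1 x) xV in leV.
have [j [S [SV cS monoS]]] := HM T (V :\ x) (fun A => f (x |: A)) leM.
have [aj0|aj0] := posnP (a j).
  exists j, set0; rewrite sub0set cards0; split=> //.
  by move=> A; rewrite subset0 => /eqP ->; rewrite cards0.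
pose b i := if i == j then (a j).-1 else a i.
have sb : \sum_(i < l) b i <= s.
  rewrite (bigD1 j) //= (eq_bigr a); last by move=> i; rewrite /b => /negbTE ->.
  by rewrite /b eqxx -ltnS -addSn prednK //; rewrite (bigD1 j) in sa.
have leS : N' <= #|S| by rewrite cS.
have [i [W [WS cW monoW]]] := IHs b sb T S f leS.
have WV : W \subset V :\ x := fintype.subset_trans WS SV.
move: cW; rewrite /b; case: eqVneq => [eij|nij] cW; last first.
  by exists i, W; split=> //; apply: fintype.subset_trans WV (subD1set _ _).
have xW : x \notin W by apply/negP => /(subsetP WV); rewrite !inE eqxx.
exists j, (x |: W); split.
- by rewrite subUset sub1set xV; apply: fintype.subset_trans WV (subD1set _ _).
- by rewrite cardsU1 xW cW add1n prednK.
move=> A AxW cA; have [xA|xA] := boolP (x \in A).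
  have -> : A = x |: (A :\ x) by rewrite setD1K.
  apply: monoS; last by move: cA; rewrite (cardsD1 x) xA => -[].
  by apply: fintype.subset_trans WS; rewrite subDset.
rewrite -eij; apply: monoW => //; apply/subsetP => y yA.
have := subsetP AxW y yA; rewrite !inE => /orP[/eqP yx|//].
by rewrite -yx yA in xA.
Qed.

Lemma ramsey_exists (k n l : nat) : exists N, ramsey_prop k n l N.
Proof.
have [M HM] := ramsey_sets l k n; exists (maxn k M).
apply/forallP => chi.
have /set0Pn[A0 A0k] :
    [set B : {set 'I_(maxn k M)} | B \subset [set: _] & #|B| == k] != set0.
  by rewrite -card_gt0 cards_draws bin_gt0 cardsT card_ord leq_maxl.
have kA0 : #|A0| == k by move: A0k; rewrite inE => /andP[].
pose f (A : {set 'I_(maxn k M)}) := chi (insubd (exist _ A0 kA0 : ksubset _ k) A).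
have [|i [S [_ cS monoS]]] := HM _ [set: 'I_(maxn k M)] f.
  by rewrite cardsT card_ord leq_maxr.
apply/existsP; exists S; rewrite cS eqxx /=.
have chiE (A : ksubset _ k) : val A \subset S -> chi A = i.
  by move=> AS; rewrite -(monoS (val A) AS (eqP (valP A))) /f valKd.
apply/forallP => A; apply/forallP => B; apply/implyP => /andP[AS BS].
by rewrite !chiE.
Qed.

Definition ramsey_number (k n l : nat) : nat := ex_minn (ramsey_exists k n l).

(* Indexed from 1: [tower 1 x = x] and [tower i.+1 x = 2 `^ tower i x] for
   [i >= 1]; the value at index 0 is meaningless. *)
Definition tower (R : realType) (k : nat) (x : R) : R :=
  iter k.-1 (fun y : R => powR 2%R y) x.

(* Main.v *)
Require Import Defs.
From mathcomp Require Import all_boot all_order all_algebra.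
From mathcomp Require Import reals exp.
From mathcomp Require Import zify.

Set Implicit Arguments.
Unset Strict Implicit.
Unset Printing Implicit Defensive.

(** Stepping up after Erdos-Hajnal and Conlon-Fox-Sudakov. Given a coloring [f]
of the [k]-subsets of [[0, N)], a [(k+1)]-subset [x_0 < ... < x_k] of
[[0, 2^N)] is sent to the sequence of the [delta x_i x_(i+1)], the highest binary
digits where consecutive elements differ. If this sequence is monotone, the subset
gets the [f]-color of the set of its digits; otherwise its color records whether
the first local extremum is a maximum or a minimum, and the parity of its position.
In a monochromatic set all windows of [k+1] consecutive elements have the same
color. Shifting a window by one flips the parity of the first extremum, so (when
[k >= 4]) the first extremum of the whole sequence is next to an end; a second
extremum would be the first one of some other window, with the opposite type. So
all the digits but one at an end are monotone, and they form a set on which [f] is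
constant: a step costs only two elements. The first steps start from random graphs:
for [k = 2] the pair (direction, [f]-color) can be used, and for [k = 3] one
loses a factor two. *)

(** * Consecutive steps of a sequence and highest differing digits *)

Definition steps (T S : Type) (r : T -> T -> S) (s : seq T) : seq S :=
  if s is x :: s' then pairmap r x s' else [::].

Lemma size_steps T S (r : T -> T -> S) s : size (steps r s) = (size s).-1.
Proof. by case: s => //= x s; rewrite size_pairmap. Qed.

Lemma steps_drop T S (r : T -> T -> S) n s :
  steps r (drop n s) = drop n (steps r s).
Proof. by elim: s n => [|x [|y s] IH] [|n] //; rewrite [LHS]IH. Qed.

Lemma steps_take T S (r : T -> T -> S) n s :
  steps r (take n s) = take n.-1 (steps r s).
Proof.
by elim: s n => [|x [|y s] IH] [|[|n]] //; congr cons; rewrite -[RHS](IH n.+1).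
Qed.

Fact delta_exists x y : exists d, x %/ 2 ^ d.+1 == y %/ 2 ^ d.+1.
Proof.
exists (x + y); rewrite !divn_small //.
  by apply: leq_ltn_trans (ltn_expl _ (isT : 1 < 2)); lia.
by apply: leq_ltn_trans (ltn_expl _ (isT : 1 < 2)); lia.
Qed.

(* The highest binary digit in which [x] and [y] differ; [delta x x = 0]. *)
Definition delta x y := ex_minn (delta_exists x y).

Lemma delta_le x y d : (delta x y <= d) = (x %/ 2 ^ d.+1 == y %/ 2 ^ d.+1).
Proof.
rewrite /delta; case: ex_minnP => e /eqP exy min_e; apply/idP/idP => [le_ed|/min_e//].
by rewrite -(subnKC le_ed) -addSn expnD !divnMA exy.
Qed.

Lemma delta_ltn N x y : x < 2 ^ N -> x < y -> y < 2 ^ N -> delta x y < N.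
Proof.
case: N => [|N] xN xy yN; first by rewrite expn0 in yN; lia.
by rewrite ltnS delta_le !divn_small.
Qed.

(** Quotients by a power of two are monotone, so those of [x] and [z] agree iff both agree with that
    of [y]. *)
Lemma delta_max x y z : x < y -> y < z ->
  delta x z = maxn (delta x y) (delta y z).
Proof.
move=> xy yz; have H d : (delta x z <= d) = (maxn (delta x y) (delta y z) <= d).
  rewrite geq_max !delta_le; set q := 2 ^ d.+1.
  have := leq_div2r q (ltnW xy); have := leq_div2r q (ltnW yz); lia.
by apply/eqP; rewrite eqn_leq H leqnn -H leqnn.
Qed.

(** With a common value [d], the quotients of [x < y < z] by [2 ^ d] would be three distinct
    integers with the same half, rounded down. *)
Lemma delta_neq x y z : x < y -> y < z -> delta x y != delta y z.
Proof.
move=> xy yz; apply/eqP => e; set d := delta y z in e.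
have qn a b : a < b -> delta a b = d -> a %/ 2 ^ d < b %/ 2 ^ d.
  move=> ab ed; rewrite ltn_neqAle leq_div2r ?(ltnW ab) // andbT.
  case: d ed {e} => [|d] ed; first by rewrite expn0 !divn1; lia.
  by rewrite -delta_le ed ltnn.
have := qn _ _ xy e; have := qn _ _ yz erefl.
have : delta x y <= d by rewrite e.
have : delta y z <= d by [].
rewrite !delta_le expnSr !divnMA; lia.
Qed.

(** * Monotone digit sequences and the points that realize their subsequences *)

Notation deltas := (steps delta).
Notation ups := (steps ltn).
(** A decreasing digit sequence is read backwards, since [f] is only controlled on increasing
    sequences. *)
Definition orient (T : Type) (b : bool) (d : seq T) := if b then d else rev d.

Lemma deltas_neq s : sorted ltn s -> sorted (fun a b => a != b) (deltas s).
Proof.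
elim: s => [|x [|y [|z s]] IH] //= /and3P[xy yz p].
by rewrite delta_neq //=; apply: IH; rewrite /= yz.
Qed.

Lemma sorted_ups (b : bool) d : sorted (fun a b => a != b) d ->
  all (pred1 b) (ups d) = sorted (if b then ltn else gtn) d.
Proof.
elim: d => [|x [|y d] IH] //= /andP[xy p]; rewrite [X in _ && X]IH //.
by case: b {IH} => /=; case: (ltngtP x y) xy.
Qed.

Lemma sorted_orient b d :
  sorted (if b then ltn else gtn) d -> sorted ltn (orient b d).
Proof. by case: b => //; rewrite /orient rev_sorted. Qed.

Lemma gtn_trans : transitive (fun x y : nat => x > y).
Proof. by move=> y x z yx zy; apply: ltn_trans zy yx. Qed.

(** By [delta_max], dropping a point merges its two adjacent digits into the larger, here the later
    one. So an unwanted digit is removed with the point that ends its step, and the first point [x]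
    is always kept. *)
Lemma realize_incr x s a : path ltn x s -> sorted ltn (pairmap delta x s) ->
  subseq a (pairmap delta x s) ->
  exists2 a' : seq nat, subseq a' s & pairmap delta x a' = a.
Proof.
elim: s x a => [|y s IH] x a /=; first by move=> _ _ /eqP->; exists [::].
move=> /andP[xy ps] pd; have sd := path_sorted pd.
case: a => [|d a] /=; first by exists [::]; rewrite ?sub0seq.
case: eqP => [->|_] sub_a; have [a' sa' ea'] := IH y _ ps sd sub_a.
  by exists (y :: a'); rewrite /= ?eqxx ?ea'.
case: a' sa' ea' => // z a' sa' [ed ea'].
exists (z :: a'); first exact: subseq_trans sa' (subseq_cons _ _).
rewrite /= ea'; congr cons.
have yz : y < z.
  by move: ps; rewrite (path_sortedE ltn_trans) => /andP[/allP/(_ z)-> //];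
     apply: (mem_subseq sa'); rewrite inE eqxx.
rewrite (delta_max xy yz) ed; apply/maxn_idPr/ltnW.
have dm : d \in pairmap delta y s.
  by apply: (mem_subseq sub_a); rewrite inE eqxx.
move: pd; rewrite (path_sortedE ltn_trans) => /andP[/allP/(_ d dm)//].
Qed.

Lemma delta_decr x y s z : path ltn x (y :: s) ->
  sorted gtn (pairmap delta x (y :: s)) -> z \in y :: s ->
  delta x z = delta x y.
Proof.
elim: s x y => [|w s IH] x y; first by rewrite inE => _ _ /eqP->.
move=> /= /andP[xy pw] /andP[lt_d pd]; rewrite inE => /predU1P[->//|zs].
have yz : y < z.
  by move: pw; rewrite -/(path ltn y (w :: s)) (path_sortedE ltn_trans) => /andP[/allP/(_ z zs)].
by rewrite (delta_max xy yz) (IH y w) //; apply/maxn_idPl/ltnW.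
Qed.

(** Now the earlier digit survives a merge, so an unwanted digit is removed with the point that
    starts its step. The first point may go too, hence the existential [y]. *)
Lemma realize_decr x s a : path ltn x s -> sorted gtn (pairmap delta x s) ->
  subseq a (pairmap delta x s) ->
  exists (y : nat) (a' : seq nat), subseq (y :: a') (x :: s) /\ pairmap delta y a' = a.
Proof.
elim: s x a => [|y s IH] x a.
  by move=> _ _ /eqP->; exists x, [::]; rewrite /= eqxx.
move=> ps pd; have ps' := path_sorted ps; have sd : sorted gtn (pairmap delta y s).
  exact: path_sorted pd.
case: a => [|d a]; first by exists x, [::]; rewrite /= eqxx.
rewrite [pairmap _ _ _]/= [subseq _ _]/=.
case: eqP => [->|_] /(IH y _ ps' sd) [z [a' [sub_a' ea']]].
  exists x, (z :: a'); split; first by rewrite /= eqxx.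
  rewrite /= ea'; congr cons; apply: delta_decr ps pd _.
  by apply: (mem_subseq sub_a'); rewrite inE eqxx.
by exists z, a'; split=> //; apply: subseq_trans sub_a' (subseq_cons _ _).
Qed.

Lemma realize (b : bool) s a : sorted ltn s ->
  sorted (if b then ltn else gtn) (deltas s) -> subseq a (deltas s) ->
  exists2 a' : seq nat, subseq a' s & deltas a' = a.
Proof.
case: s => [|x s]; first by move=> _ _ /eqP->; exists [::].
case: b => /= ps sd sub_a.
  have [a' sub_a' ea'] := realize_incr ps sd sub_a.
  by exists (x :: a'); rewrite //= eqxx.
have [y [a' [sub_a' ea']]] := realize_decr ps sd sub_a.
by exists (y :: a').
Qed.

(** * The stepping-up argument in general form *)

Lemma all_deltas N s : sorted ltn s -> all (fun x => x < 2 ^ N) s ->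
  all (fun d => d < N) (deltas s).
Proof.
elim: s => [|x [|y s] IH] //= /andP[xy p] /and3P[xN yN sN].
by rewrite delta_ltn //=; apply: IH; rewrite //= yN.
Qed.

Lemma orientK (T : Type) b : involutive (@orient T b).
Proof. by case: b => //; apply: revK. Qed.

Lemma size_orient (T : Type) b (s : seq T) : size (orient b s) = size s.
Proof. by case: b; rewrite //= size_rev. Qed.

Lemma all_orient (T : Type) p b (s : seq T) : all p (orient b s) = all p s.
Proof. by case: b; rewrite //= all_rev. Qed.

Lemma subseq_orient b (s t : seq nat) :
  subseq s t -> subseq (orient b s) (orient b t).
Proof. by case: b => //; rewrite subseq_rev. Qed.

(** Increasing sequences stand for sets, so a coloring is a function on all sequences and only its
    values on increasing ones matter. *)
Definition mono (C : Type) (f : seq nat -> C) k s :=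
  forall a b : seq nat, subseq a s -> subseq b s -> size a = k -> size b = k -> f a = f b.

Definition avoids (C : Type) (f : seq nat -> C) k n N :=
  forall s, sorted ltn s -> size s = n -> all (fun x => x < N) s -> ~ mono f k s.

(** A set monochromatic for [F] has [n.+1] consecutive points with monotone digits. Every
    [k]-subsequence of these [n] digits lifts to [k.+1] of the points, so the digits would be
    monochromatic for [f]. *)
Lemma step_up (C C' : Type) (f : seq nat -> C) (F : seq nat -> C') k n m N :
  0 < k -> avoids f k n N ->
  (forall (b : bool) a1 a2, size a1 = k.+1 -> size a2 = k.+1 ->
     all (pred1 b) (ups (deltas a1)) -> all (pred1 b) (ups (deltas a2)) ->
     F a1 = F a2 -> f (orient b (deltas a1)) = f (orient b (deltas a2))) ->
  (forall s, sorted ltn s -> size s = m -> mono F k.+1 s ->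
     exists (b : bool) t, t + n < m /\
       all (pred1 b) (take n.-1 (drop t (ups (deltas s))))) ->
  avoids F k.+1 m (2 ^ N).
Proof.
move=> k0 avf Ff run s0 sort0 size0 all0 mono0.
have [b [t [tn_m]]] := run _ sort0 size0 mono0.
(* A run of [n.-1] directions spans [n] digits and [n.+1] points. *)
pose s := take n.+1 (drop t s0).
have s_s0 : subseq s s0 by apply: subseq_trans (take_subseq _ _) (drop_subseq _ _).
have size_s : size s = n.+1 by rewrite size_takel // size_drop size0; move: tn_m; clear; lia.
have monoF : mono F k.+1 s by move=> a1 a2 s1 s2; apply: mono0; apply: subseq_trans s_s0.
have sort_s : sorted ltn s := subseq_sorted ltn_trans s_s0 sort0.
have all_s : all (fun x => x < 2 ^ N) s.
  by apply/allP => x /(mem_subseq s_s0) /(allP all0).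
rewrite -steps_drop -steps_take -[n]/(n.+1.-1) -!steps_drop -steps_take -/s => up_s.
have sd : sorted (if b then ltn else gtn) (deltas s).
  by rewrite -sorted_ups ?deltas_neq.
apply: (avf (orient b (deltas s))).
- exact: sorted_orient.
- by rewrite size_orient size_steps size_s.
- by rewrite all_orient all_deltas.
have lift (a : seq nat) : subseq a (orient b (deltas s)) -> size a = k ->
    exists a' : seq nat,
    [/\ subseq a' s, size a' = k.+1, all (pred1 b) (ups (deltas a')) &
        a = orient b (deltas a')].
  move=> sub_a size_a.
  have := subseq_orient b sub_a; rewrite orientK => sub_ba.
  have [a' sub_a' ea'] := realize sort_s sd sub_ba.
  exists a'; rewrite ea' orientK; split=> //.
    have := size_steps delta a'; rewrite ea' size_orient size_a; lia.
  rewrite sorted_ups; last by rewrite -ea' deltas_neq ?(subseq_sorted ltn_trans sub_a').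
  by case: b sd sub_ba {up_s sub_a ea'} => sd /subseq_sorted; apply; rewrite //; [apply: ltn_trans|apply: gtn_trans].
move=> a1 a2 /lift h1 /lift h2 /h1[a1' [s1 z1 u1 ->]] /h2[a2' [s2 z2 u2 ->]].
by apply: Ff => //; apply: monoF.
Qed.

(** * Runs and changes in sequences of directions *)

Lemma all_run (b : bool) (u : seq bool) t r : t + r <= size u ->
  (forall j, t <= j -> j < t + r -> nth true u j = b) ->
  all (pred1 b) (take r (drop t u)).
Proof.
move=> le_tr nth_b; apply/(all_nthP true) => j.
rewrite size_takel ?size_drop => [j_r|]; last by lia.
by rewrite nth_take // nth_drop /= nth_b //; lia.
Qed.

Lemma first_change (u : seq bool) t :
  (forall j, t <= j -> j < size u -> nth true u j = nth true u t) \/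
  exists i, [/\ t < i, i < size u,
    forall j, t <= j -> j < i -> nth true u j = nth true u t &
    nth true u i = ~~ nth true u t].
Proof.
set b := nth true u t; set v := drop t u.
have nth_v j : t <= j -> nth true u j = nth true v (j - t).
  by move=> tj; rewrite nth_drop subnKC.
have [hasv|] := boolP (~~ b \in v); last first.
  move=> nv; left=> j tj ju; rewrite nth_v //.
  have : nth true v (j - t) \in v by rewrite mem_nth // size_drop ltn_sub2r // (leq_ltn_trans tj).
  by move: nv; case: (nth true v _); case: (b) => // /negP.
have lt_v : index (~~ b) v < size u - t by rewrite -size_drop index_mem.
right; exists (t + index (~~ b) v); split; last by rewrite -nth_drop nth_index.
- rewrite -[ltnLHS]addn0 ltn_add2l lt0n; apply/eqP => e0.
  by have := nth_index true hasv; rewrite e0 nth_drop addn0 -/b; case: (b).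
- lia.
move=> j tj jv; have : j - t < index (~~ b) v by lia.
by move/(before_find true); rewrite -nth_v //=; case: (nth true u j); case: (b).
Qed.

(* [u] lists the directions (up or down) of the steps of a digit sequence, so the
   first local extremum is the first change in [u], a maximum iff [u] starts up. *)
Definition signature (u : seq bool) :=
  (head true u, odd (index (~~ head true u) u)).

Definition const_head (u : seq bool) := all (pred1 (head true u)) u.

Lemma signature_window (b : bool) (u : seq bool) w t i :
  t < i -> i < t + w -> t + w <= size u ->
  (forall j, t <= j -> j < i -> nth true u j = b) -> nth true u i = ~~ b ->
  ~~ const_head (take w (drop t u)) /\
  signature (take w (drop t u)) = (b, odd (i - t)).
Proof.
move=> ti iw wu nth_b nth_i; set W := take w (drop t u).
have sizeW : size W = w by rewrite size_takel // size_drop; lia.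
have nthW j : j < w -> nth true W j = nth true u (t + j).
  by move=> jw; rewrite nth_take // nth_drop.
have headW : head true W = b by rewrite -nth0 nthW ?nth_b; lia.
have nthWi : nth true W (i - t) = ~~ b by rewrite nthW ?subnKC //; lia.
have Wi : ~~ b \in W by rewrite -nthWi mem_nth // sizeW; lia.
rewrite /const_head /signature headW; split.
  by apply/negP => /allP/(_ _ Wi) /=; case: (b).
congr (_, odd _); have iW : index (~~ b) W < w by rewrite -sizeW index_mem.
case: (ltngtP (index (~~ b) W) (i - t)) => // lt_i.
  have := nth_index true Wi; rewrite nthW // nth_b ?leq_addr //.
    by case: (b).
  by rewrite -ltn_subRL.
by have := before_find true lt_i; rewrite nthWi /= eqxx.
Qed.

Lemma long_run (u : seq bool) w : 2 < w -> w < size u ->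
  (forall t1 t2, t1 + w <= size u -> t2 + w <= size u ->
     ~~ const_head (take w (drop t1 u)) -> ~~ const_head (take w (drop t2 u)) ->
     signature (take w (drop t1 u)) = signature (take w (drop t2 u))) ->
  exists (b : bool) t, t + (size u).-1 <= size u /\
    all (pred1 b) (take (size u).-1 (drop t u)).
Proof.
move=> w2 wu sigE; have [cst|[i [i0 iu pre_i ui]]] := first_change u 0.
  exists (nth true u 0), 0; split; first by lia.
  by apply: all_run => [|j _ ju]; [lia | apply: cst; lia].
set b := nth true u 0 in pre_i ui.
have [i_big|i_small] := leqP 2 i.
  have [i_last|i_mid] := leqP (size u).-1 i.
    exists b, 0; split; first by lia.
    by apply: all_run => [|j _ ju]; [lia | apply: pre_i; lia].
  (* The earliest window containing [i] and the next one both have their first change at [i], with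
     opposite parities; [2 < w] ensures that the second one still starts before [i]. *)
  pose t := i.+1 - w.
  have [|||j tj ji|c1 s1] := signature_window (b := b) (t := t) (w := w) _ _ _ _ ui;
    try by rewrite /t; lia.
    by apply: pre_i.
  have [|||j tj ji|c2 s2] := signature_window (b := b) (t := t.+1) (w := w) _ _ _ _ ui;
    try by rewrite /t; lia.
    by apply: pre_i.
  have le1 : t + w <= size u by rewrite /t; lia.
  have le2 : t.+1 + w <= size u by rewrite /t; lia.
  have := sigE _ _ le1 le2 c1 c2; rewrite s1 s2 => -[]; rewrite /t; lia.
have i1 : i = 1 by lia.
rewrite {i}i1 in i0 iu pre_i ui i_small.
have [cst|[j [j1 ju pre_j uj]]] := first_change u 1.
  exists (~~ b), 1; split; first by lia.
  by apply: all_run => [|j j1 ju]; [lia | rewrite cst ?ui //; lia].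
rewrite ui negbK in pre_j uj.
have [|||j' tj ji|c1 s1] := signature_window (b := b) (t := 0) (w := w) _ _ _ _ ui;
    try by lia.
  by apply: pre_i.
(* The window has to reach [j] but start at 1 or later, so that it opens with [~~ b] and its first
   change is of the opposite type. *)
pose t := maxn 1 (j.+1 - w).
have [|||j' tj ji||c2 s2] := signature_window (b := ~~ b) (t := t) (w := w) (i := j) (u := u);
  try by rewrite /t; lia.
  by apply: pre_j => //; rewrite /t in tj; lia.
have le1 : 0 + w <= size u by lia.
have le2 : t + w <= size u by rewrite /t; lia.
by have := sigE _ _ le1 le2 c1 c2; rewrite s1 s2 => -[]; case: (b).
Qed.

(** A window of two directions can only change at its second one, so parity carries no information.
    The types still forbid a second change, and the longer of the two constant stretches covers at
    least half. *)
Lemma half_run (u : seq bool) r : 0 < r -> r.*2 <= size u ->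
  (forall t1 t2, t1 + 2 <= size u -> t2 + 2 <= size u ->
     ~~ const_head (take 2 (drop t1 u)) -> ~~ const_head (take 2 (drop t2 u)) ->
     signature (take 2 (drop t1 u)) = signature (take 2 (drop t2 u))) ->
  exists (b : bool) t, t + r <= size u /\ all (pred1 b) (take r (drop t u)).
Proof.
move=> r0 ru sigE; have [cst|[i [i0 iu pre_i ui]]] := first_change u 0.
  exists (nth true u 0), 0; split; first by lia.
  by apply: all_run => [|j _ ju]; [lia | apply: cst; lia].
set b := nth true u 0 in pre_i ui.
have [cst|[j [ij ju pre_j uj]]] := first_change u i.
  have [ri|ir] := leqP r i.
    exists b, 0; split; first by lia.
    by apply: all_run => [|j _ ji]; [lia | apply: pre_i; lia].
  exists (~~ b), i; split; first by lia.
  by apply: all_run => [|j ij ju]; [lia | rewrite cst ?ui //; lia].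
rewrite ui negbK in pre_j uj.
have [|||k tk ki|c1 s1] := signature_window (b := b) (t := i.-1) (w := 2) _ _ _ _ ui;
    try by lia.
  by apply: pre_i; lia.
have [|||k tk ki||c2 s2] := signature_window (b := ~~ b) (t := j.-1) (w := 2) (i := j) (u := u);
  try by lia.
  by apply: pre_j => //; lia.
have le1 : i.-1 + 2 <= size u by lia.
have le2 : j.-1 + 2 <= size u by lia.
by have := sigE _ _ le1 le2 c1 c2; rewrite s1 s2 => -[]; case: (b).
Qed.

(** * The colorings used in the steps, and the cost of each step *)

(** A triple has a single direction, so recording it makes all digits of a monochromatic set
    monotone. *)
Definition graph_step_color (C : Type) (f : seq nat -> C) a :=
  let u := ups (deltas a) in (head true u, f (orient (head true u) (deltas a))).

(** Signatures reuse the colors of [f], which keeps their number at four. Clashes between monotone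
    and non-monotone subsets do no harm: the run is found by comparing non-monotone windows only,
    and [f] is recovered from monotone ones. *)
Definition step_color f a : bool * bool :=
  let u := ups (deltas a) in
  if const_head u then f (orient (head true u) (deltas a)) else signature u.

Lemma ups_window n t s : t + n <= size s ->
  [/\ subseq (take n (drop t s)) s, size (take n (drop t s)) = n &
      ups (deltas (take n (drop t s))) = take n.-2 (drop t (ups (deltas s)))].
Proof.
move=> le_n; split; first by apply: subseq_trans (take_subseq _ _) (drop_subseq _ _).
  by rewrite size_takel // size_drop; lia.
by rewrite !steps_take !steps_drop.
Qed.

Lemma all_head (b : bool) u : 0 < size u -> all (pred1 b) u -> head true u = b.
Proof. by case: u => //= x u _ /andP[/eqP]. Qed.

Lemma size_ups s : size (ups (deltas s)) = (size s).-2.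
Proof. by rewrite !size_steps. Qed.

Lemma step_up_graph (C : Type) (f : seq nat -> C) n N :
  avoids f 2 n N -> avoids (graph_step_color f) 3 n.+1 (2 ^ N).
Proof.
move=> avf; apply: step_up avf _ _ => //.
  move=> b a1 a2 z1 z2 u1 u2 [_].
  by rewrite (all_head _ u1) ?(all_head _ u2) // size_ups ?z1 ?z2.
move=> s sort_s size_s mono_s; exists (head true (ups (deltas s))), 0; split=> //.
apply: all_run; first by rewrite size_ups size_s; lia.
move=> j _ jn; have [|s1 z1 e1] := @ups_window 3 0 s; rewrite ?size_s; try lia.
have [|s2 z2 e2] := @ups_window 3 j s; rewrite ?size_s; try lia.
have [+ _] := mono_s _ _ s1 s2 z1 z2; rewrite -!nth0 e1 e2 !nth_take // !nth_drop.
by rewrite !addn0 => <-; rewrite nth0.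
Qed.

Lemma step_color_signature f k s t1 t2 : mono (step_color f) k s ->
  t1 + k <= size s -> t2 + k <= size s ->
  let W t := take k.-2 (drop t (ups (deltas s))) in
  ~~ const_head (W t1) -> ~~ const_head (W t2) ->
  signature (W t1) = signature (W t2).
Proof.
move=> mono_s t1s t2s /= c1 c2.
have [s1 z1 e1] := ups_window t1s; have [s2 z2 e2] := ups_window t2s.
have := mono_s _ _ s1 s2 z1 z2.
by rewrite /step_color e1 e2 (negbTE c1) (negbTE c2).
Qed.

Lemma step_color_mono f k (b : bool) a1 a2 : 1 < k ->
  size a1 = k.+1 -> size a2 = k.+1 ->
  all (pred1 b) (ups (deltas a1)) -> all (pred1 b) (ups (deltas a2)) ->
  step_color f a1 = step_color f a2 ->
  f (orient b (deltas a1)) = f (orient b (deltas a2)).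
Proof.
move=> k1 z1 z2 u1 u2; rewrite /step_color /const_head.
by rewrite (all_head _ u1) ?(all_head _ u2) ?u1 ?u2 // size_ups ?z1 ?z2; lia.
Qed.

(** The [n.*2] points have [n.-1.*2] directions, and half of these make a run spanning [n]
    digits. *)
Lemma step_up_triple f n N : 1 < n -> avoids f 3 n N ->
  avoids (step_color f) 4 n.*2 (2 ^ N).
Proof.
move=> n1 avf; apply: step_up avf _ _ => //.
  by move=> b a1 a2; apply: step_color_mono.
move=> s sort_s size_s mono_s.
have zu : size (ups (deltas s)) = n.-1.*2 by rewrite size_ups size_s; lia.
have [|||b [t [tn all_b]]] := @half_run (ups (deltas s)) n.-1.
- lia.
- by rewrite zu.
- by move=> t1 t2; rewrite zu => t1u t2u; apply: (step_color_signature mono_s); rewrite size_s; lia.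
by exists b, t; split=> //; lia.
Qed.

(** The [n.+2] points have [n] directions, of which [long_run] loses one. The windows have [k.-1]
    directions, more than two because [3 < k]. *)
Lemma step_up_add2 f k n N : 3 < k -> k <= n -> avoids f k n N ->
  avoids (step_color f) k.+1 n.+2 (2 ^ N).
Proof.
move=> k3 kn avf; apply: step_up avf _ _; first by lia.
  by move=> b a1 a2; apply: step_color_mono; lia.
move=> s sort_s size_s mono_s.
have zu : size (ups (deltas s)) = n by rewrite size_ups size_s.
have [|||b [t [tn all_b]]] := @long_run (ups (deltas s)) k.-1.
- lia.
- by lia.
- by move=> t1 t2; rewrite zu => t1u t2u; apply: (step_color_signature mono_s); rewrite size_s; lia.
by exists b, t; split; [lia | rewrite -zu].
Qed.

(** * From increasing sequences to finite sets and Ramsey numbers *)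

Definition set_of_seq N (a : seq nat) : {set 'I_N} := [set i : 'I_N | val i \in a].

Lemma set_of_seq_vals N (A : {set 'I_N}) :
  set_of_seq N (map val (enum A)) = A.
Proof. by apply/setP => i; rewrite inE mem_map ?mem_enum //; apply: val_inj. Qed.

Lemma card_set_of_seq N a : uniq a -> all (fun x => x < N) a ->
  #|set_of_seq N a| = size a.
Proof.
move=> ua /allP aN; rewrite cardE -(size_map val).
apply/perm_size/uniq_perm => //; first by rewrite map_inj_uniq ?enum_uniq //; apply: val_inj.
move=> x; apply/mapP/idP => [[i]|xa]; first by rewrite mem_enum inE => ? ->.
by exists (Ordinal (aN x xa)); rewrite ?mem_enum ?inE.
Qed.

Lemma sorted_vals N (A : {set 'I_N}) : sorted ltn (map val (enum A)).
Proof.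
rewrite {1}/enum_mem -enumT.
have: sorted ltn (map val (enum 'I_N)) by rewrite val_enum_ord iota_ltn_sorted.
apply: subseq_sorted; first exact: ltn_trans.
by apply: map_subseq; apply: filter_subseq.
Qed.

Lemma subseq_vals N (A B : {set 'I_N}) : A \subset B ->
  subseq (map val (enum A)) (map val (enum B)).
Proof.
move=> /subsetP AB; apply: map_subseq.
suff -> : enum A = filter (mem A) (enum B) by apply: filter_subseq.
rewrite /enum_mem -filter_predI; apply: eq_filter => i /=.
by case: (boolP (i \in A)) => // /AB ->.
Qed.

Lemma vals_set_of_seq N a : sorted ltn a -> all (fun x => x < N) a ->
  map val (enum (set_of_seq N a)) = a.
Proof.
move=> sa aN; apply: (irr_sorted_eq ltn_trans ltnn (sorted_vals _) sa) => x.
apply/mapP/idP => [[i]|xa]; first by rewrite mem_enum inE => ? ->.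
by exists (Ordinal (allP aN x xa)); rewrite ?mem_enum ?inE.
Qed.

Lemma avoids_leN (C : Type) (f : seq nat -> C) k n N M :
  M <= N -> avoids f k n N -> avoids f k n M.
Proof.
by move=> MN av s ss zs /allP as_; apply: av => //; apply/allP => x /as_ /leq_trans->.
Qed.

Lemma avoids_len (C : Type) (f : seq nat -> C) k n m N :
  n <= m -> avoids f k n N -> avoids f k m N.
Proof.
move=> nm av s ss zs as_ mono_s; have sub := take_subseq s n.
apply: (av (take n s)); rewrite ?size_takel ?zs //.
- exact: (subseq_sorted ltn_trans sub ss).
- by apply/allP => x /(mem_subseq sub) /(allP as_).
by move=> a b sa sb; apply: mono_s; apply: subseq_trans sub.
Qed.

Lemma avoids_ramsey (C : finType) (f : seq nat -> C) k n l N :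
  #|C| <= l -> avoids f k n N -> N < ramsey_number k n l.
Proof.
move=> Cl av; rewrite /ramsey_number; case: ex_minnP => M ramM _.
rewrite ltnNge; apply/negP => MN.
pose chi : coloring M k l :=
  [ffun A : ksubset M k => widen_ord Cl (enum_rank (f (map val (enum (val A)))))].
have /existsP[S /andP[/eqP cS /forallP mono_S]] := forallP ramM chi.
apply: (avoids_leN MN av (sorted_vals S)); first by rewrite size_map -cardE.
  by apply/allP => _ /mapP[i _ ->]; apply: ltn_ord.
have sub_set a : subseq a (map val (enum S)) -> size a = k ->
    exists2 A : ksubset M k, val A \subset S & map val (enum (val A)) = a.
  move=> sub_a za; have sa := subseq_sorted ltn_trans sub_a (sorted_vals S).
  have aM : all (fun x => x < M) a.
    by apply/allP => x /(mem_subseq sub_a) /mapP[i _ ->]; apply: ltn_ord.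
  have kA : #|set_of_seq M a| == k.
    by rewrite card_set_of_seq ?za // (sorted_uniq ltn_trans ltnn).
  exists (exist (fun A : {set 'I_M} => #|A| == k) _ kA); rewrite /= ?vals_set_of_seq //.
  apply/subsetP => i; rewrite inE => /(mem_subseq sub_a) /mapP[j].
  by rewrite mem_enum => jS /val_inj->.
move=> a b sa sb za zb.
have [A AS <-] := sub_set a sa za; have [B BS <-] := sub_set b sb zb.
have /forallP/(_ B) := mono_S A; rewrite AS BS /= !ffunE => /eqP.
by move=> /(congr1 val) /= /val_inj /enum_rank_inj.
Qed.

(** * Random colorings and the base case of graphs *)

Lemma leq_card_bigcup (I T : finType) (P : pred I) (A : I -> {set T}) :
  #|\bigcup_(i | P i) A i| <= \sum_(i | P i) #|A i|.
Proof.
elim/big_rec2: _ => [|i m B _ le_m]; first by rewrite cards0.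
by apply: leq_trans (leq_card_setU _ _) _; rewrite leq_add2l.
Qed.

(* First moment method: a uniformly random two-coloring. *)
Lemma avoids_counting k n N :
  'C(N, n) * 2 < 2 ^ 'C(n, k) -> exists f : seq nat -> bool, avoids f k n N.
Proof.
move=> lt_count; pose T := {set 'I_N}.
pose E (S : T) : {set T} := [set A : T | A \subset S & #|A| == k].
pose bad (S : T) (c : bool) : {set {ffun T -> bool}} :=
  [set F : {ffun T -> bool} | [forall A in E S, F A == c]].
(* Being bad fixes the color of ['C(n, k)] subsets and leaves all others free: a probability of
   [2 ^ - 'C(n, k)], written without division. *)
have card_bad (S : T) c : #|S| = n -> #|bad S c| * 2 ^ 'C(n, k) = 2 ^ #|{: T}|.
  move=> cS; pose Q (A : T) : pred bool := if A \in E S then pred1 c else predT.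
  have -> : #|bad S c| = #|(family Q : {pred {ffun T -> bool}})|.
    apply: eq_card => F; rewrite !inE; apply/forall_inP/familyP => h A.
      by rewrite /Q; case: ifP => // /h.
    by move=> AE; have := h A; rewrite /Q AE.
  rewrite card_family foldrE big_map enumT -/(index_enum T) (bigID (mem (E S))) /=.
  rewrite (eq_bigr (fun=> 1)) => [|A AE]; last by rewrite /Q AE card1.
  rewrite [X in _ * X * _](eq_bigr (fun=> 2)) => [|A /negbTE AE]; last first.
    by rewrite /Q AE cardT enumT unlock.
  rewrite !prod_nat_const exp1n mul1n -cS -cards_draws -expnD; congr (2 ^ _).
  by rewrite addnC -(cardC (E S)); congr (_ + _); apply: eq_card.
pose draws : {set T} := [set S : T | S \subset [set: 'I_N] & #|S| == n].
pose U := \bigcup_(p in setX draws [set: bool]) bad p.1 p.2.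
have card_U : #|U| * 2 ^ 'C(n, k) <= 'C(N, n) * 2 * 2 ^ #|{: T}|.
  apply: leq_trans (leq_mul (leq_card_bigcup _ _) (leqnn _)) _.
  rewrite big_distrl /= (eq_bigr (fun=> 2 ^ #|{: T}|)).
    by rewrite sum_nat_const cardsX cards_draws !cardsT card_ord card_bool.
  by case=> S c; rewrite !inE => /andP[/andP[_ /eqP cS] _]; apply: card_bad.
have [F FU] : exists F, F \notin U.
  apply/existsP; rewrite -negb_forall; apply/negP => /forallP allU.
  have : #|U| = 2 ^ #|{: T}|.
    by rewrite -card_bool -card_ffun -cardsT; apply: eq_card => F; rewrite allU inE.
  move=> eU; move: card_U; rewrite eU leqNgt [X in _ < X]mulnC ltn_pmul2r ?expn_gt0 //.
  by rewrite lt_count.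
exists (fun a => F (set_of_seq N a)) => s ss zs sN mono_s.
have cS : #|set_of_seq N s| = n by rewrite card_set_of_seq ?zs // (sorted_uniq ltn_trans ltnn).
have offcolor c : exists2 a, subseq a s /\ size a = k & F (set_of_seq N a) = ~~ c.
  have : F \notin bad (set_of_seq N s) c.
    apply: contra FU => FB; apply/bigcupP; exists (set_of_seq N s, c) => //.
    by rewrite !inE cS subsetT eqxx.
  rewrite inE negb_forall_in => /exists_inP[A]; rewrite inE => /andP[AS /eqP cA] FA.
  exists (map val (enum A)); last by rewrite set_of_seq_vals; case: (F A) c FA => [] [].
  by rewrite -[X in subseq _ X](vals_set_of_seq ss sN) subseq_vals // size_map -cardE.
have [a [sa za] Fa] := offcolor true; have [b [sb zb] Fb] := offcolor false.
by have := mono_s a b sa sb za zb; rewrite Fa Fb.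
Qed.


Lemma leq_bin_exp N n : 'C(N, n) <= N ^ n.
Proof.
elim: n N => [|n IH] N; first by rewrite bin0.
apply: leq_trans (leq_pmull _ (ltn0Sn n)) _.
rewrite -mul_bin_diag expnS leq_mul2l; apply/orP; right.
by apply: leq_trans (IH _) _; case: n {IH} => [|n]; rewrite ?expn0 ?leq_exp2r ?leq_pred.
Qed.

(** Taking [n %/ 4], about half the exponent of the classical bound, pays for the crude estimate
    ['C(N, n) <= N ^ n] and makes the count work from [n = 4] on. *)
Lemma avoids_graph n : 3 < n ->
  exists f : seq nat -> bool, avoids f 2 n (2 ^ (n %/ 4)).
Proof.
move=> n3; apply: avoids_counting.
apply: leq_ltn_trans (leq_mul (leq_bin_exp _ _) (leqnn 2)) _.
rewrite -expnM -expnSr ltn_exp2l // bin2; set q := n %/ 4.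
have q4 : q * 4 <= n by apply: leq_trunc_div.
have : 2 * (q * n + 2) <= n * n.-1 by nia.
lia.
Qed.

(** * Iterating the steps; the lower bound over the natural numbers *)

(** The set size is [p] for graphs, [p.+1] for triples and [p.+1.*2] for quadruples, then grows by
    two per step; each step adds one exponential to the initial [2 ^ (p %/ 4)]. *)
Lemma avoids_steps p j : 3 < p -> exists f : seq nat -> bool * bool,
  avoids f (4 + j) (p.+1.*2 + j.*2) (iter (3 + j) (expn 2) (p %/ 4)).
Proof.
move=> p3; elim: j => [|j [f avf]].
  have [f avf] := avoids_graph p3; exists (step_color (graph_step_color f)).
  by rewrite !addn0; apply: (step_up_triple _ (step_up_graph avf)); lia.
exists (step_color f); rewrite (doubleS j) !addnS; apply: step_up_add2 avf; lia.
Qed.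

Lemma avoids_pred C (f : seq nat -> C) k n : 0 < n -> avoids f k n n.-1.
Proof.
move=> n0 s ss zs sN; have := max_card (mem (set_of_seq n.-1 s)).
by rewrite card_set_of_seq ?(sorted_uniq ltn_trans ltnn) // zs card_ord; lia.
Qed.

Lemma ramsey_number_lower k n l : 0 < k -> 3 * k <= n -> 3 < l ->
  exists2 e, n <= 100 * e & iter k.-1 (expn 2) e < ramsey_number k n l.
Proof.
move=> k0 kn l4; have card_le : #|{: bool * bool}| <= l by rewrite card_prod card_bool.
have card_le1 : #|{: bool}| <= l by rewrite card_bool; lia.
case: k k0 kn => [//|[|[|[|j]]]] _ kn.
- exists n.-1; first by lia.
  have av : avoids (fun=> true) 1 n n.-1 by apply: avoids_pred; lia.
  exact: (avoids_ramsey card_le1 av).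
- have [|f avf] := @avoids_graph n; first by lia.
  by exists (n %/ 4); [lia | apply: avoids_ramsey avf].
- have [|f avf] := @avoids_graph n.-1; first by lia.
  exists (n.-1 %/ 4); first by lia.
  have := step_up_graph avf; rewrite prednK; last by lia.
  exact: avoids_ramsey.
(* The largest [p] with [p.+1.*2 + j.*2 <= n]. As [k = j + 4] and [3 * k <= n], the [j] last steps
   use less than two thirds of [n], so [p] stays linear in [n]; the factor 100 generously absorbs
   all rounding. *)
pose p := (n - j.*2)./2.-1.
have [|f avf] := @avoids_steps p j; first by rewrite /p; lia.
exists (p %/ 4); first by rewrite /p; lia.
by apply: avoids_ramsey card_le (avoids_len _ avf); rewrite /p; lia.
Qed.

(** * Passage to real towers *)

Import Order.TTheory GRing.Theory Num.Theory.
Local Open Scope ring_scope.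

Lemma tower_le_iter (R : realType) k (x : R) e :
  x <= e%:R -> tower k x <= (iter k.-1 (expn 2) e)%:R.
Proof.
move=> xe; rewrite /tower; elim: k.-1 => //= j IH.
by rewrite natrX -powR_mulrn // ler_powR // ler1n.
Qed.

Theorem mainTheorem3 (R : realType) :
  exists c : R, 0 < c /\
    (forall k n l : nat, (1 <= k)%N -> (3 * k <= n)%N -> (4 <= l)%N ->
       (ramsey_number k n l)%:R > tower k (c * n%:R)) /\
    (forall k n : nat, (1 <= k)%N -> (3 * k <= n)%N ->
       (ramsey_number k n 4)%:R > tower k (c * n%:R)).
Proof.
exists (100%:R^-1); split; first by rewrite invr_gt0 ltr0n.
suff lower k n l : (1 <= k)%N -> (3 * k <= n)%N -> (4 <= l)%N ->
    (ramsey_number k n l)%:R > tower k (100%:R^-1 * n%:R : R).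
  by split=> [|k n k0 kn]; [exact: lower | exact: lower].
move=> k0 kn l4; have [e ne lt_e] := ramsey_number_lower k0 kn l4.
apply: (@le_lt_trans _ _ (iter k.-1 (expn 2) e)%:R); last by rewrite ltr_nat.
apply: tower_le_iter; rewrite mulrC ler_pdivrMr ?ltr0n //.
by rewrite -natrM ler_nat mulnC.
Qed.
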